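(* Let $T \in \mathcal{B}_{A}(\mathcal{H})$. Then the following inequalities hold, where (i) and (ii) hold for every $\alpha\in[0,1]$: (i) $$\|T\|_{A_\alpha}^2 \geq \max\left\{\frac{1}{2}\left\|\frac{\alpha}{4}(T^{\sharp_A}T+TT^{\sharp_A})+(1-\alpha) T^{\sharp_A}T\right\|_{A},\ \frac{1}{3}\left\|\frac{\alpha}{2}(T^{\sharp_A}T+TT^{\sharp_A})+(1-\alpha) T^{\sharp_A}T\right\|_{A}\right\};$$ (ii) $$\|T\|_{A_\alpha}^2 \leq \left\|\frac{\alpha}{2}(T^{\sharp_A}T+TT^{\sharp_A})+(1-\alpha) T^{\sharp_{A}}T\right\|_{A};$$ (iii) $$w_{A}^2(T) \leq \min_{\alpha\in[0,1]} \left\|\frac{\alpha}{2}(T^{\sharp_A}T+TT^{\sharp_A})+(1-\alpha) T^{\sharp_A}T\right\|_{A} \leq \frac{1}{2}\left\|T^{\sharp_A}T+TT^{\sharp_A}\right\|_{A}.$$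
   Context: $\mathcal{H}$ is a complex Hilbert space with inner product $\langle\cdot,\cdot\rangle$, $\mathcal{B}(\mathcal{H})$ is the algebra of bounded linear operators on $\mathcal{H}$, and $A\in\mathcal{B}(\mathcal{H})$ is a fixed positive operator (self-adjoint with $\langle Ax,x\rangle\ge 0$ for all $x\in\mathcal{H}$). Put $\langle x,y\rangle_A=\langle Ax,y\rangle$ and $\|x\|_A=\sqrt{\langle x,x\rangle_A}=\|A^{1/2}x\|$. $R(\cdot)$ denotes range. Let $\mathcal{B}_A(\mathcal{H})=\{T\in\mathcal{B}(\mathcal{H}) : R(T^*A)\subseteq R(A)\}$, a subalgebra of $\mathcal{B}(\mathcal{H})$ whose elements $T$ are $A$-bounded (there is $c>0$ with $\|Tx\|_A\le c\|x\|_A$ for all $x\in\mathcal{H}$). For $T\in\mathcal{B}_A(\mathcal{H})$, $T^{\sharp_A}$ denotes the unique solution $X\in\mathcal{B}(\mathcal{H})$ of $AX=T^*A$ with $R(X)\subseteq\overline{R(A)}$; it again belongs to $\mathcal{B}_A(\mathcal{H})$. For an $A$-bounded operator $T$: - the $A$-operator semi-norm is $\|T\|_A=\sup\{\|Tx\|_A/\|x\|_A : x\in\overline{R(A)},\ x\ne 0\}$; - the $A$-numerical radius is $w_A(T)=\sup\{|\langle Tx,x\rangle_A| : x\in\mathcal{H},\ \|x\|_A=1\}$; - for $\alpha\in[0,1]$, $\|T\|_{A_\alpha}=\sup\left\{\sqrt{\alpha|\langle Tx,x\rangle_A|^2+(1-\alpha)\|Tx\|_A^2} : x\in\mathcal{H},\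 \|x\|_A=1\right\}$. *)

(* Defs.v *)
From mathcomp Require Export all_boot all_order all_algebra.
From mathcomp Require Export complex.
From mathcomp Require Export all_classical all_reals all_analysis.

Set Implicit Arguments.
Unset Strict Implicit.
Unset Printing Implicit Defensive.

Export Order.TTheory GRing.Theory Num.Theory.
Export numFieldNormedType.Exports.

Global Open Scope classical_set_scope.
Global Open Scope ring_scope.
Global Open Scope complex_scope.

(* A complex Hilbert space is a complete normed R[i]-module H with an inner
   product ip, linear in its first and conjugate-linear in its second argument,
   such that `|x| = sqrt <x, x>; the last equation is a hypothesis wherever it
   is needed. Operators are bare functions H -> H, so that sums, scalings and
   composites are those of functions; [bounded_operator] is the membership in
   B(H). *)
Section SemiHilbert.
Variables (R : realType) (H : completeNormedModType R[i]).
Variable ip : {dot H for @Num.conj R[i]}.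
Implicit Types A T S X : H -> H.

Definition bounded_operator T : Prop :=
  linear T /\ exists c : R, forall x, `|T x| <= c%:C * `|x|.

Definition is_adjoint T S : Prop := forall x y, ip (T x) y = ip x (S y).

Definition adjoint T : H -> H :=
  xget (cst 0) [set S | bounded_operator S /\ is_adjoint T S].

Definition positive_operator A : Prop :=
  [/\ bounded_operator A, is_adjoint A A & forall x, 0 <= ip (A x) x].

Definition BA A T : Prop :=
  bounded_operator T /\ range (adjoint T \o A) `<=` range A.

Definition is_sharp A T X : Prop :=
  [/\ bounded_operator X, A \o X = adjoint T \o A
    & range X `<=` closure (range A)].

Definition sharp A T : H -> H := xget (cst 0) [set X | is_sharp A T X].

Definition ipA A x y : R[i] := ip (A x) y.

(* <x, x>_A is a nonnegative real, hence equal to its real part. *)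
Definition normA A x : R := Num.sqrt (complex.Re (ipA A x x)).

(* The three suprema are real-valued; the supremum of the empty set, which
   occurs exactly when A = 0, is 0. *)
Definition opnormA A T : R :=
  sup [set normA A (T x) / normA A x
      | x in [set x | closure (range A) x /\ x != 0]].

Definition numradA A T : R :=
  sup [set Normc.normc (ipA A (T x) x) | x in [set x | normA A x = 1]].

Definition normA_alpha A (alpha : R) T : R :=
  sup [set Num.sqrt (alpha * Normc.normc (ipA A (T x) x) ^+ 2
                     + (1 - alpha) * normA A (T x) ^+ 2)
      | x in [set x | normA A x = 1]].

End SemiHilbert.

Definition is_minimum (R : realType) (E : set R) (m : R) : Prop :=
  E m /\ lbound E m.

(* Main.v *)
Require Import Defs.
From mathcomp Require Import ring lra zify.

Set Implicit Arguments.
Unset Strict Implicit.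
Unset Printing Implicit Defensive.

(* The operator [Ts] satisfies [<Tx, y>_A = <x, Ts y>_A], so that
   [<Ts T x, x>_A = |Tx|_A^2] and [<T Ts x, x>_A = |Ts x|_A^2]. The combinations
   in the statement are therefore A-self-adjoint and A-positive, and for such an
   operator [U] polarization gives [|U|_A = sup <Ux, x>_A]. Hence all bounds
   reduce to pointwise ones on A-unit vectors. For the upper bounds this is
   [|<Tx, x>_A|^2 <= (|Tx|_A^2 + |Ts x|_A^2) / 2]; for the lower ones it is
   [|Tx|_A^2 + |Ts x|_A^2 <= 4 w^2] with [w] the A-numerical radius, which is
   the parallelogram law for [T + Ts] and [T - Ts]. The minimum exists because the
   A-norm of the combination is Lipschitz in [alpha].
   Existence of [Ts] is Douglas' theorem: a solution [u] of [A u = T^* A x] is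
   projected on the closure of the range of [A], and the resulting operator [X]
   is bounded by the uniform boundedness principle for the functionals
   [x |-> <Xx, Az> / |Az|]. The suprema are finite because [T] is A-bounded: for
   the A-self-adjoint [S = Ts T], Cauchy-Schwarz gives
   [|S^m x|_A^2 <= |S^(2m) x|_A |x|_A], whence [|Sx|_A <= c |x|_A] by iterating
   along [m = 2^n]. *)

(** * Complex numbers and real quadratics *)

Section ComplexNumbers.
Variable R : realType.
Implicit Types z w : R[i].

Lemma ReD z w : complex.Re (z + w) = complex.Re z + complex.Re w.
Proof. by case: z; case: w. Qed.

Lemma Re_realM (k : R) z : complex.Re (k%:C * z) = k * complex.Re z.
Proof. by case: z => a b /=; rewrite mul0r subr0. Qed.

Lemma Re_conjc z : complex.Re (conjc z) = complex.Re z.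
Proof. by case: z. Qed.

Lemma normc_ge0 z : 0 <= Normc.normc z.
Proof. by case: z => a b; apply: sqrtr_ge0. Qed.

Lemma sqr_normc_Re_Im z :
  Normc.normc z ^+ 2 = complex.Re z ^+ 2 + complex.Im z ^+ 2.
Proof. by case: z => a b /=; rewrite sqr_sqrtr// addr_ge0// sqr_ge0. Qed.

Lemma normc_real (k : R) : Normc.normc k%:C = `|k|.
Proof. by rewrite /= expr0n /= addr0 sqrtr_sqr. Qed.

Lemma conjc_mul_normc z : conjc z * z = (Normc.normc z ^+ 2)%:C.
Proof.
rewrite sqr_normc_Re_Im; case: z => a b; apply/eqP; rewrite eq_complex /=.
by apply/andP; split; apply/eqP; ring.
Qed.

Lemma normc_conjc z : Normc.normc (conjc z) = Normc.normc z.
Proof. by case: z => a b /=; rewrite sqrrN. Qed.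

Lemma Re_le_normc z : `|complex.Re z| <= Normc.normc z.
Proof.
rewrite -ler_sqr ?nnegrE ?normc_ge0 ?normr_ge0//.
by rewrite real_normK ?num_real// sqr_normc_Re_Im lerDl sqr_ge0.
Qed.

End ComplexNumbers.

(** For [c > 0] the minimum over [t] is [a - b^2 / c]; for [c = 0] a nonconstant affine function of
    [t] would take negative values. *)
Lemma quadratic_ge0 (R : realType) (a b c : R) : 0 <= a -> 0 <= c ->
  (forall t, 0 <= a + 2 * t * b + t ^+ 2 * c) -> b ^+ 2 <= a * c.
Proof.
move=> a0 c0 h.
have [c_eq0|cn0] := eqVneq c 0.
  subst c; rewrite mulr0; have [->|bn0] := eqVneq b 0; first by rewrite expr0n.
  (* This [t] solves [a + 2 t b = -1]. *)
  have := h (- (a + 1) / (2 * b)).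
  have -> : a + 2 * (- (a + 1) / (2 * b)) * b + (- (a + 1) / (2 * b)) ^+ 2 * 0
    = -1 by field.
  by rewrite oppr_ge0 ler10.
have c_gt0 : 0 < c by rewrite lt_def cn0.
have := h (- b / c).
have -> : a + 2 * (- b / c) * b + (- b / c) ^+ 2 * c = (a * c - b ^+ 2) / c.
  by field.
by rewrite pmulr_lge0 ?invr_gt0// subr_ge0.
Qed.

(** * Semi-inner products *)

(** A symmetric real-bilinear form. At [A = id] it is the real inner product of [H], so one set of
    lemmas serves both the A-seminorm and the Hilbert norm. *)
Definition reA (R : realType) (H : completeNormedModType R[i])
    (ip : {dot H for @Num.conj R[i]}) (A : H -> H) (x y : H) : R :=
  complex.Re (ipA ip A x y).

Section SemiInnerProduct.
Variables (R : realType) (H : completeNormedModType R[i]).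
Variable ip : {dot H for @Num.conj R[i]}.
Variable A : H -> H.
Hypothesis A_pos : positive_operator ip A.
Implicit Types (x y z : H) (k : R[i]) (r t : R).

Lemma op_add (T : H -> H) : bounded_operator T -> {morph T : x y / x + y}.
Proof. by case=> lT _ x y; have := lT 1 x y; rewrite !scale1r. Qed.

Lemma op_0 (T : H -> H) : bounded_operator T -> T 0 = 0.
Proof.
by move=> bT; apply: (addrI (T 0)); rewrite -op_add// !addr0.
Qed.

Lemma op_scale (T : H -> H) : bounded_operator T -> scalable T.
Proof.
by move=> bT k x; have := bT.1 k x 0; rewrite !addr0 op_0// addr0.
Qed.

Let A_bdd : bounded_operator A. Proof. by case: A_pos. Qed.

Lemma ipC x y : ip x y = conjc (ip y x).
Proof. by rewrite hermC expr0 mul1r. Qed.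

Lemma ipA_conj x y : ipA ip A x y = conjc (ipA ip A y x).
Proof. by case: A_pos => _ adjA _; rewrite /ipA adjA ipC. Qed.

Lemma ipADl x y z : ipA ip A (x + y) z = ipA ip A x z + ipA ip A y z.
Proof. by rewrite /ipA op_add// linearDl. Qed.

Lemma ipADr x y z : ipA ip A z (x + y) = ipA ip A z x + ipA ip A z y.
Proof. by rewrite /ipA linearDr. Qed.

Lemma ipAZl k x z : ipA ip A (k *: x) z = k * ipA ip A x z.
Proof. by rewrite /ipA op_scale// linearZl_LR. Qed.

Lemma ipAZr k x z : ipA ip A z (k *: x) = conjc k * ipA ip A z x.
Proof. by rewrite /ipA linearZr_LR. Qed.

Lemma reAC x y : reA ip A x y = reA ip A y x.
Proof. by rewrite /reA ipA_conj Re_conjc. Qed.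

Lemma reADl x y z : reA ip A (x + y) z = reA ip A x z + reA ip A y z.
Proof. by rewrite /reA ipADl ReD. Qed.

Lemma reADr x y z : reA ip A z (x + y) = reA ip A z x + reA ip A z y.
Proof. by rewrite /reA ipADr ReD. Qed.

Lemma reAZl r x z : reA ip A (r%:C *: x) z = r * reA ip A x z.
Proof. by rewrite /reA ipAZl Re_realM. Qed.

Lemma reAZr r x z : reA ip A z (r%:C *: x) = r * reA ip A z x.
Proof. by rewrite reAC reAZl reAC. Qed.

Lemma reANl x z : reA ip A (- x) z = - reA ip A x z.
Proof. by rewrite -scaleN1r -[-1](rmorphN1 (real_complex R)) reAZl mulN1r. Qed.

Lemma reANr x z : reA ip A z (- x) = - reA ip A z x.
Proof. by rewrite reAC reANl reAC. Qed.

Lemma reA_ge0 x : 0 <= reA ip A x x.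
Proof.
case: A_pos => _ _ /(_ x); rewrite /reA /ipA.
by case: (ip _ _) => a b; rewrite lecE /= => /andP[].
Qed.

Lemma normA_ge0 x : 0 <= normA ip A x.
Proof. exact: sqrtr_ge0. Qed.

Lemma sqr_normA x : normA ip A x ^+ 2 = reA ip A x x.
Proof. by rewrite sqr_sqrtr// reA_ge0. Qed.

Lemma sqr_normAD x y :
  normA ip A (x + y) ^+ 2
  = normA ip A x ^+ 2 + 2 * reA ip A x y + normA ip A y ^+ 2.
Proof. by rewrite !sqr_normA !(reADl, reADr) (reAC y x); ring. Qed.

Lemma normAZ k x : normA ip A (k *: x) = Normc.normc k * normA ip A x.
Proof.
apply/eqP; rewrite -(@eqrXn2 _ 2)// ?mulr_ge0 ?normc_ge0 ?normA_ge0//.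
rewrite exprMn !sqr_normA /reA ipAZl ipAZr mulrA [k * _]mulrC conjc_mul_normc.
by rewrite Re_realM.
Qed.

Lemma normAZr r x : normA ip A (r%:C *: x) = `|r| * normA ip A x.
Proof. by rewrite normAZ normc_real. Qed.

Lemma normAN x : normA ip A (- x) = normA ip A x.
Proof.
by rewrite -scaleN1r -[-1](rmorphN1 (real_complex R)) normAZr normrN1 mul1r.
Qed.

(** Discriminant bound for the quadratic [t |-> |x + t y|_A^2], valid also when [y] has A-seminorm
    zero. *)
Lemma reA_CauchySchwarz x y : `|reA ip A x y| <= normA ip A x * normA ip A y.
Proof.
rewrite -ler_sqr ?nnegrE ?normr_ge0 ?mulr_ge0 ?normA_ge0//.
rewrite real_normK ?num_real// exprMn.
apply: quadratic_ge0 => [||t]; rewrite ?sqr_ge0//.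
suff -> : normA ip A x ^+ 2 + 2 * t * reA ip A x y + t ^+ 2 * normA ip A y ^+ 2
  = normA ip A (x + t%:C *: y) ^+ 2 by rewrite sqr_ge0.
by rewrite sqr_normAD reAZr normAZr exprMn real_normK ?num_real//; ring.
Qed.

(** Multiplying [x] by the conjugate of [z] turns the form into the real number [|z|^2]; the real
    inequality is then divided by [|z|]. *)
Lemma ipA_CauchySchwarz x y :
  Normc.normc (ipA ip A x y) <= normA ip A x * normA ip A y.
Proof.
set z := ipA ip A x y.
have [z0|zn0] := eqVneq (Normc.normc z) 0.
  by rewrite z0 mulr_ge0 ?normA_ge0.
have z_gt0 : 0 < Normc.normc z by rewrite lt_def zn0 normc_ge0.
have := le_trans (ler_norm _) (reA_CauchySchwarz (conjc z *: x) y).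
rewrite normAZ normc_conjc -mulrA /reA ipAZl conjc_mul_normc.
by rewrite -[complex.Re _]/(Normc.normc z ^+ 2) expr2 ler_pM2l.
Qed.

Lemma ler_normAD x y : normA ip A (x + y) <= normA ip A x + normA ip A y.
Proof.
rewrite -ler_sqr ?nnegrE ?addr_ge0 ?normA_ge0// sqr_normAD sqrrD.
rewrite lerD2r lerD2l mulr_natl ler_pMn2r//.
exact: le_trans (ler_norm _) (reA_CauchySchwarz x y).
Qed.

Lemma ler_normAB x y : normA ip A (x - y) <= normA ip A x + normA ip A y.
Proof. by rewrite -(normAN y) ler_normAD. Qed.

Lemma normA_parallelogram x y :
  normA ip A (x + y) ^+ 2 + normA ip A (x - y) ^+ 2
  = 2 * (normA ip A x ^+ 2 + normA ip A y ^+ 2).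
Proof. by rewrite !sqr_normAD normAN reANr; ring. Qed.

End SemiInnerProduct.

(** * Minimisation in a Hilbert space *)

Section HilbertSpace.
Variables (R : realType) (H : completeNormedModType R[i]).
Variable ip : {dot H for @Num.conj R[i]}.
Hypothesis ip_norm : forall x : H, `|x| = sqrtC (ip x x).
Implicit Types (x y z : H) (k : R[i]) (r t e : R) (S T : H -> H).

Local Notation hn := (normA ip id).
Local Notation rp := (reA ip id).

Lemma id_positive : positive_operator ip id.
Proof.
by split=> //; split=> //; exists 1 => x; rewrite mul1r.
Qed.
Let idP := id_positive.

(** Passes from the [R[i]]-valued norm of [H] to the real-valued [hn], in which all estimates are
    made. *)
Lemma norm_hn x : `|x| = (hn x)%:C.
Proof.
rewrite ip_norm; apply/eqP; rewrite -(@eqrXn2 _ 2)// ?sqrtC_ge0 ?dnorm_ge0//.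
  rewrite sqrtCK -rmorphXn /= (sqr_normA idP).
  have : 0 <= ip x x by rewrite dnorm_ge0.
  rewrite /reA /ipA; case: (ip x x) => a b.
  by rewrite lecE /= => /andP[/eqP -> _].
by rewrite ler0c normA_ge0.
Qed.

Lemma pos_complexP k : 0 < k -> exists2 e, 0 < e & k = e%:C.
Proof.
case: k => a b; rewrite ltcE /= => /andP[/eqP -> a0].
by exists a.
Qed.

Lemma hn_eq0 x : hn x = 0 -> x = 0.
Proof. by move=> h; apply/eqP; rewrite -normr_eq0 norm_hn h. Qed.

Lemma hn0 : hn 0 = 0.
Proof. by rewrite /normA /ipA linear0l sqrtr0. Qed.

Lemma closure_hnP (B : set H) x :
  closure B x <-> forall e, 0 < e -> exists2 y, B y & hn (x - y) < e.
Proof.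
split=> [cB e e0|h V /nbhs_ballP[k /pos_complexP[e e0 ->]] bV].
  have /cB[y [By]] : nbhs x (ball x e%:C) by apply: nbhsx_ballx; rewrite ltcR.
  by rewrite -ball_normE /ball_ /= norm_hn ltcR; exists y.
have [y By xy] := h e e0; exists y; split=> //; apply: bV.
by rewrite -ball_normE /ball_ /= norm_hn ltcR.
Qed.

Lemma hn_complete (u : nat -> H) :
  (forall e, 0 < e -> exists N, forall n, (N <= n)%N -> hn (u N - u n) < e) ->
  exists l, forall e, 0 < e ->
    exists N, forall n, (N <= n)%N -> hn (l - u n) < e.
Proof.
move=> cu.
have : cvg (u @ \oo).
  apply: cauchy_cvg; apply: cauchy_exP => k /pos_complexP[e e0 ->].
  have [N hN] := cu e e0; exists (u N), N => // n /= Nn.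
  by rewrite -ball_normE /ball_ /= norm_hn ltcR hN.
move=> cvgu; exists (lim (u @ \oo)) => e e0.
have /cvgrPdist_lt/(_ e%:C) := cvgu.
rewrite ltcR => /(_ e0)[N _ hN]; exists N => n Nn.
by have := hN n Nn; rewrite /= norm_hn ltcR.
Qed.

Lemma bounded_hnP T : bounded_operator T ->
  exists2 c, 0 <= c & forall x, hn (T x) <= c * hn x.
Proof.
case=> _ [c hc]; exists `|c| => // x.
have := hc x; rewrite !norm_hn -rmorphM /= lecR => /le_trans; apply.
by rewrite ler_wpM2r ?normA_ge0// ler_norm.
Qed.

Lemma bounded_hn T c : linear T -> (forall x, hn (T x) <= c * hn x) ->
  bounded_operator T.
Proof.
by move=> lT hc; split=> //; exists c => x; rewrite !norm_hn -rmorphM lecR.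
Qed.

Lemma ip_real_ext x y : (forall z, rp z x = rp z y) -> x = y.
Proof.
move=> h; apply/eqP; rewrite -subr_eq0; apply/eqP; apply: hn_eq0.
apply/eqP; rewrite -sqrf_eq0 (sqr_normA idP) reADr (reANr idP).
by rewrite h subrr.
Qed.

(** [k = 1] compares the real parts and [k = i] the imaginary parts. *)
Lemma ip_complex_ext x y z w :
  (forall k, rp (k *: x) y = rp (k *: z) w) -> ip x y = ip z w.
Proof.
move=> h; have := h 'i%C; have := h 1; rewrite /reA !(ipAZl idP) !mul1r.
rewrite /ipA; case: (ip x y) => a b; case: (ip z w) => c d /= -> E.
by congr Complex; lra.
Qed.

(** * Minimising a quadratic functional on a closed real subspace *)

Section MinimalElement.
Variables (M : set H) (phi : H -> R) (c : R).
Hypothesis closed_M : closed M.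
Hypothesis M0 : M 0.
Hypothesis M_lin : forall t x y, M x -> M y -> M (x + t%:C *: y).
Hypothesis phi_lin : forall t x y, phi (x + t%:C *: y) = phi x + t * phi y.
Hypothesis phi_bdd : forall x, `|phi x| <= c * hn x.

(** If [phi = rp p], then [J x = |x - p|^2 - |p|^2], so a minimiser of [J] is a candidate for
    representing [phi]. *)
Let J x := hn x ^+ 2 - 2 * phi x.

Let J_lin t x y :
  J (x + t%:C *: y) = J x + 2 * t * (rp x y - phi y) + t ^+ 2 * hn y ^+ 2.
Proof.
rewrite /J (sqr_normAD idP) phi_lin (reAZr idP) (normAZr idP) exprMn.
by rewrite real_normK ?num_real//; ring.
Qed.

Let J_lbound x : - c ^+ 2 <= J x.
Proof.
have := sqr_ge0 (hn x - c); have := phi_bdd x.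
by rewrite ler_norml => /andP[_ h]; rewrite /J sqrrB => h2; nra.
Qed.

Let d := inf [set J x | x in M].

Let d_le x : M x -> d <= J x.
Proof.
move=> Mx; apply: ge_inf; last by exists x.
by exists (- c ^+ 2) => _ [y _ <-].
Qed.

Let minseq : exists u : nat -> H,
  forall n, M (u n) /\ J (u n) <= d + n.+1%:R^-1.
Proof.
have h n : exists x, M x /\ J x <= d + n.+1%:R^-1.
  have [||_ [x Mx <-] lt] := @inf_adherent _ [set J x | x in M] n.+1%:R^-1.
  - by rewrite invr_gt0.
  - split; first by exists (J 0), 0.
    by exists (- c ^+ 2) => _ [y _ <-].
  by exists x; split=> //; apply: ltW.
by have [u hu] := choice h; exists u.
Qed.

(** [J (x + t y) - d >= 0] for all [t], so the discriminant controls the derivative of [J] at an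
    almost minimal [x]. *)
Let near_min x e : M x -> J x <= d + e ->
  forall y, M y -> (rp x y - phi y) ^+ 2 <= e * hn y ^+ 2.
Proof.
move=> Mx Jx y My; apply: quadratic_ge0 => [||t]; rewrite ?sqr_ge0//.
  by have := d_le Mx; lra.
have := d_le (M_lin t Mx My); rewrite J_lin; lra.
Qed.

(* [p] minimises [|x|^2 - 2 phi x] on [M]; [M] closed covers projections and
   [M = setT] the representation of functionals. *)
Lemma real_Riesz : exists2 p, M p & forall y, M y -> rp p y = phi y.
Proof.
have [u hu] := minseq.
(* At the midpoint, [J] is the mean of [J (u m)] and [J (u n)] minus [|u m - u n|^2 / 4], and it is
   at least [d]. *)
have u_dist m n : (m <= n)%N -> hn (u m - u n) ^+ 2 <= 4 * m.+1%:R^-1.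
  move=> mn; have [Mm Jm] := hu m; have [Mn Jn] := hu n.
  have le_nm : (n.+1%:R^-1 : R) <= m.+1%:R^-1.
    by rewrite lef_pV2 ?posrE// ler_nat.
  have Mmid : M (u m + (- 2^-1)%:C *: (u m + (- 1)%:C *: u n)).
    by do 2 apply: M_lin => //.
  have := d_le Mmid; rewrite !(J_lin, reADr, phi_lin, reAZr idP).
  rewrite [hn (u m + _)](_ : _ = hn (u m - u n)); last first.
    by rewrite rmorphN1 scaleN1r.
  have := sqr_normAD idP (u m) (- u n).
  rewrite (normAN idP) (reANr idP) -(sqr_normA idP).
  move: Jm Jn le_nm; rewrite /J.
  by move: (n.+1%:R^-1 : R) (m.+1%:R^-1 : R) => a b; lra.
have [|p hp] := @hn_complete u.
  move=> e e0; have [N hN] : exists N : nat, 4 * N.+1%:R^-1 < e ^+ 2.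
    exists (Num.truncn (4 / e ^+ 2)).
    by rewrite ltr_pdivrMr// mulrC -ltr_pdivrMr ?exprn_gt0// truncnS_gt.
  exists N => n Nn; rewrite -ltr_sqr ?nnegrE ?normA_ge0 ?ltW//.
  exact: le_lt_trans (u_dist _ _ Nn) hN.
have Mp : M p.
  apply: closed_M; apply/closure_hnP => e /hp[N hN].
  by exists (u N); [have [] := hu N|exact: hN].
exists p => // y My; apply/eqP; rewrite -subr_eq0 -normr_eq0 eq_le normr_ge0.
rewrite andbT; apply/ler_addgt0Pr => e e0; rewrite add0r.
(* [K] and [f] are such that two errors of size at most [f |y|] add up to at most [2 f K = e]. *)
pose K := 1 + hn y; have K0 : 0 < K by rewrite ltr_pwDl ?normA_ge0.
pose f := e / (2 * K); have f0 : 0 < f by rewrite divr_gt0// mulr_gt0.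
have [N hN] := hp f f0.
(* Ensures both [|p - u n| <= f] and that [J (u n)] exceeds [d] by at most [f^2]. *)
pose n := maxn N (Num.truncn (f ^- 2)).
have n_small : n.+1%:R^-1 <= f ^+ 2.
  rewrite -[leRHS]invrK lef_pV2 ?posrE ?invr_gt0 ?exprn_gt0//.
  by apply: ltW; apply: lt_le_trans (truncnS_gt _) _;
  rewrite ler_nat ltnS leq_maxr.
have [Mn Jn] := hu n.
have near_n : `|rp (u n) y - phi y| <= f * hn y.
  rewrite -ler_sqr ?nnegrE ?(mulr_ge0 (ltW f0)) ?normA_ge0//.
  rewrite real_normK ?num_real// exprMn.
  exact: near_min Mn (le_trans Jn (lerD (lexx d) n_small)) _ My.
have -> : rp p y - phi y = rp (p - u n) y + (rp (u n) y - phi y).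
  by rewrite (reADl idP) (reANl idP); ring.
have pn : hn (p - u n) <= f by apply: ltW; apply: hN; rewrite leq_maxl.
have := reA_CauchySchwarz idP (p - u n) y.
have hy := normA_ge0 ip id y.
move=> pny; apply: le_trans (ler_normD _ _) _.
have -> : e = 2 * f * K by rewrite /f; field; rewrite gt_eqF.
have := ler_wpM2r hy pn; rewrite /K; nra.
Qed.

End MinimalElement.
End HilbertSpace.

(** * Adjoints and uniform boundedness *)

Section Operators.
Variables (R : realType) (H : completeNormedModType R[i]).
Variable ip : {dot H for @Num.conj R[i]}.
Hypothesis ip_norm : forall x : H, `|x| = sqrtC (ip x x).
Implicit Types (x y z : H) (k : R[i]) (r t e : R) (S T : H -> H).

Local Notation hn := (normA ip id).
Local Notation rp := (reA ip id).
Let idP := id_positive ip.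

(** [S y] represents the functional [x |-> rp (T x) y]. Linearity follows from nondegeneracy,
    boundedness from [|S y|^2 = rp (T (S y)) y]. *)
Lemma adjoint_exists T : bounded_operator T ->
  exists S, bounded_operator S /\ is_adjoint ip T S.
Proof.
move=> bT; have [c c0 hc] := bounded_hnP ip_norm bT.
have h y : exists p, forall x, rp p x = rp (T x) y.
  have [|||||p _ hp] := @real_Riesz _ _ _ ip_norm setT (fun x => rp (T x) y)
    (c * hn y) => //; last by exists p => x; exact: hp.
  - by move=> t u v; rewrite op_add// op_scale// (reADl idP) (reAZl idP).
  - move=> x; apply: le_trans (reA_CauchySchwarz idP _ _) _.
    by rewrite mulrAC ler_wpM2r ?normA_ge0.
have [S hS] := choice h.
have adj : is_adjoint ip T S.
  move=> x y; apply: ip_complex_ext => k.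
  by rewrite (reAC idP _ (S y)) hS op_scale.
exists S; split=> //; apply: (bounded_hn ip_norm (c := c)) => [k u v|y].
  apply: (ip_real_ext ip_norm) => z.
  by rewrite /reA /ipA /= -adj !linearDr !linearZr_LR /= -!adj.
have [->|Sy0] := eqVneq (hn (S y)) 0; first by rewrite mulr_ge0 ?normA_ge0.
have Sy_gt0 : 0 < hn (S y) by rewrite lt_def Sy0 normA_ge0.
rewrite -(ler_pM2l Sy_gt0) -expr2 (sqr_normA idP) hS.
apply: le_trans (ler_norm _) _; apply: le_trans (reA_CauchySchwarz idP _ _) _.
by rewrite mulrCA mulrA ler_wpM2r ?normA_ge0.
Qed.

Lemma adjointP T : bounded_operator T ->
  bounded_operator (adjoint ip T) /\ is_adjoint ip T (adjoint ip T).
Proof. by move=> bT; have := xgetPex (cst 0) (adjoint_exists bT). Qed.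

(** * Uniform boundedness for real functionals, by nested balls *)

Section UniformBoundedness.
Variables (I : Type) (phi : I -> H -> R).
Hypothesis phi_lin :
  forall i t x y, phi i (x + t%:C *: y) = phi i x + t * phi i y.
Hypothesis phi_bdd : forall i, exists c, forall x, `|phi i x| <= c * hn x.

(** If every [|phi i|] were at most [K] on the ball, comparing the values at [x] and at
    [x + (r / |y|) y] would give [|phi i y| <= (2 K / r) |y|] for all [i] and [y]. *)
Let large_somewhere x r (K : R) :
  (forall C, exists i y, C * hn y < `|phi i y|) -> 0 < r ->
  exists i z, hn (x - z) <= r /\ K < `|phi i z|.
Proof.
move=> unbdd r0; apply: contrapT => h.
have {}h i z : hn (x - z) <= r -> `|phi i z| <= K.
  by move=> xz; rewrite leNgt; apply/negP => Kz; apply: h; exists i, z.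
have [i [y]] := unbdd (2 * K / r); apply/negP; rewrite -leNgt.
have [y0|yn0] := eqVneq (hn y) 0.
  by have [c /(_ y)] := phi_bdd i; rewrite y0 !mulr0.
have y_gt0 : 0 < hn y by rewrite lt_def yn0 normA_ge0.
have := h i x; rewrite subrr hn0 => /(_ (ltW r0)) hx.
have := h i (x + (r / hn y)%:C *: y).
rewrite opprD addrA subrr add0r (normAN idP) (normAZr idP).
rewrite ger0_norm; last first.
  by rewrite divr_ge0// ltW.
rewrite divfK// lexx phi_lin => /(_ isT) hxy.
have : `|r / hn y * phi i y| <= 2 * K.
  have -> : r / hn y * phi i y = (phi i x + r / hn y * phi i y) - phi i x.
    by rewrite addrAC subrr add0r.
  apply: le_trans (ler_normB _ _) _.
  by rewrite mulr_natl mulr2n lerD.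
rewrite normrM ger0_norm; last by rewrite divr_ge0// ltW.
have -> : r / hn y * `|phi i y| = `|phi i y| / (hn y / r).
  by field; rewrite yn0 gt_eqF.
by rewrite ler_pdivrMr ?divr_gt0// [hn y / r]mulrC mulrA.
Qed.

(** At some [z] a value [|phi i z|] exceeds [K + 1]; on a ball of radius at most [1 / c'] around [z]
    it drops by at most 1. *)
Let smaller_ball x r (K : R) :
  (forall C, exists i y, C * hn y < `|phi i y|) -> 0 < r ->
  exists x' r', [/\ 0 < r', r' <= r / 2, hn (x - x') <= r / 2
    & exists i, forall z, hn (x' - z) <= r' -> K <= `|phi i z|].
Proof.
move=> unbdd r0; have r2_gt0 : 0 < r / 2 by rewrite divr_gt0.
have [i [z [xz Kz]]] := large_somewhere x (K + 1) unbdd r2_gt0.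
have [c hc] := phi_bdd i.
pose c' := `|c| + 1; have c'_gt0 : 0 < c' by rewrite ltr_wpDl.
exists z, (Num.min (r / 2) c'^-1); split=> //.
- by rewrite lt_min r2_gt0 invr_gt0.
- by rewrite ge_min lexx.
exists i => w; rewrite le_min => /andP[_ zw].
have : `|phi i (z - w)| <= 1.
  apply: le_trans (hc _) _; apply: le_trans (_ : c' * hn (z - w) <= _).
    by rewrite ler_wpM2r ?normA_ge0// /c' (le_trans (ler_norm c))// lerDl.
  by rewrite -ler_pdivlMl// mulr1.
have -> : w = z + (- 1)%:C *: (z - w).
  by rewrite rmorphN1 scaleN1r opprB addrC subrK.
rewrite phi_lin mulN1r opprD addrA subrr add0r.
rewrite rmorphN1 scaleN1r opprK => h.
have := lerB_dist (phi i z) (phi i (z - w)).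
lra.
Qed.

(** Otherwise there are shrinking nested balls on which ever larger lower bounds hold for some
    functional, and their common point contradicts pointwise boundedness. *)
Lemma uniform_boundedness :
  (forall x, exists K, forall i, `|phi i x| <= K) ->
  exists C, forall i x, `|phi i x| <= C * hn x.
Proof.
move=> ptwise; apply: contrapT => noC.
have unbdd C : exists i y, C * hn y < `|phi i y|.
  apply: contrapT => h; apply: noC; exists C => i x.
  by rewrite leNgt; apply/negP => hx; apply: h; exists i, x.
(* [p] is a stage number with a centre and a radius. The value [(0, 0)] at nonpositive radii makes
   the step total, so that choice yields a function to iterate. *)
have step (p : nat * (H * R)) : exists q : H * R, 0 < p.2.2 ->
    [/\ 0 < q.2, q.2 <= p.2.2 / 2, hn (p.2.1 - q.1) <= p.2.2 / 2
    & exists i, forall z, hn (q.1 - z) <= q.2 -> p.1%:R <= `|phi i z|].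
  case: p => n [x r] /=; have [r0|rN] := ltP 0 r; last by exists (0, 0).
  by have [x' [r' h]] := smaller_ball x n%:R unbdd r0; exists (x', r').
have [f hf] := choice step.
pose fix s n := if n is m.+1 then f (m, s m) else (0 : H, 1 : R).
have s_gt0 n : 0 < (s n).2.
  by elim: n => [|n IH] /=; rewrite ?ltr01//; have [] := hf (n, s n) IH.
have s_step n := hf (n, s n) (s_gt0 n).
have s_small n : (s n).2 <= n.+1%:R^-1.
  elim: n => [|n IH]; first by rewrite invr1.
  have [_ le_half _ _] := s_step n; apply: le_trans le_half _.
  apply: le_trans (ler_wpM2r _ IH) _ => //.
  by rewrite -invfM -natrM lef_pV2 ?posrE// ler_nat; lia.
(* Bounding the distance of the centres by the difference of the radii means that the balls are
   nested; it also puts the limit in each of them. *)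
have nested n m : (n <= m)%N -> hn ((s n).1 - (s m).1) <= (s n).2 - (s m).2.
  elim: m => [|m IH]; first by rewrite leqn0 => /eqP ->; rewrite !subrr hn0.
  rewrite leq_eqVlt => /orP[/eqP <-|nm]; first by rewrite !subrr hn0.
  have [r2 d] : (s m.+1).2 <= (s m).2 / 2
      /\ hn ((s m).1 - (s m.+1).1) <= (s m).2 / 2 by have [_ ? ? _] := s_step m.
  move: (s m.+1) r2 d => q r2 d; have {}IH := IH nm.
  have -> : (s n).1 - q.1 = ((s n).1 - (s m).1) + ((s m).1 - q.1).
    by rewrite addrA subrK.
  apply: le_trans (ler_normAD idP _ _) _; lra.
have small e : 0 < e -> exists N : nat, N.+1%:R^-1 < e.
  move=> e0; exists (Num.truncn e^-1).
  by rewrite -[ltRHS]invrK ltf_pV2 ?posrE ?invr_gt0// truncnS_gt.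
have [e e0|l hl] := @hn_complete _ _ _ ip_norm (fun n => (s n).1).
  have [N hN] := small e e0; exists N => n Nn.
  apply: le_lt_trans (nested _ _ Nn) _.
  by apply: le_lt_trans hN; apply: le_trans (s_small N); rewrite gerBl ltW.
have l_in n : hn ((s n).1 - l) <= (s n).2.
  apply/ler_addgt0Pr => e e0; have [N hN] := hl e e0.
  have := hN (maxn N n) (leq_maxl _ _).
  have := nested n (maxn N n) (leq_maxr _ _).
  have := s_gt0 (maxn N n).
  have -> : (s n).1 - l
    = ((s n).1 - (s (maxn N n)).1) - (l - (s (maxn N n)).1).
    by rewrite opprB addrA subrK.
  have := ler_normAB idP ((s n).1 - (s (maxn N n)).1) (l - (s (maxn N n)).1).
  lra.
have [K hK] := ptwise l.
(* The functional found at stage [n] is at least [n] in absolute value on the ball of index [n.+1],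
   hence the shift to [.+2] below. *)
have [_ _ _ [i hi]] := s_step (Num.truncn K).+1.
have := hi l (l_in (Num.truncn K).+2); apply/negP; rewrite -ltNge.
exact: le_lt_trans (hK i) (truncnS_gt _).
Qed.

End UniformBoundedness.
End Operators.

(** * Douglas' theorem *)

Section Sharp.
Variables (R : realType) (H : completeNormedModType R[i]).
Variable ip : {dot H for @Num.conj R[i]}.
Hypothesis ip_norm : forall x : H, `|x| = sqrtC (ip x x).
Variable A : H -> H.
Hypothesis A_pos : positive_operator ip A.
Implicit Types (x y z : H) (k : R[i]) (r t e : R) (S T X : H -> H).

Local Notation hn := (normA ip id).
Local Notation rp := (reA ip id).
Local Notation M := (closure (range A)).
Let idP := id_positive ip.
Let A_bdd : bounded_operator A. Proof. by case: A_pos. Qed.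

Let rp_adj x y : rp (A x) y = rp x (A y).
Proof. by case: A_pos => _ adjA _; rewrite /reA /ipA /= adjA. Qed.

Lemma closure_range_lin k x y : M x -> M y -> M (k *: x + y).
Proof.
move=> /(closure_hnP ip_norm) Mx /(closure_hnP ip_norm) My.
apply/(closure_hnP ip_norm) => e e0.
pose c := Normc.normc k + 1; have c0 : 0 < c by rewrite ltr_wpDl ?normc_ge0.
have [|_ [a _ <-] xa] := Mx (e / 2 / c); first by rewrite !divr_gt0.
have [|_ [b _ <-] yb] := My (e / 2); first by rewrite divr_gt0.
exists (A (k *: a + b)); first by exists (k *: a + b).
rewrite op_add// op_scale// opprD addrACA -scalerBr.
apply: le_lt_trans (ler_normAD idP _ _) _; rewrite (normAZ idP).
rewrite [ltRHS](splitr e) ler_ltD//.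
apply: le_trans (ler_wpM2r _ (_ : _ <= c)) _; rewrite ?normA_ge0 ?lerDl//.
by rewrite mulrC -ler_pdivlMr// ltW.
Qed.

(** The kernel of the self-adjoint [A] is orthogonal to its range, so [|x|^2 = rp x (x - A z)] for
    every [z], and [A z] can be taken close to [x]. *)
Lemma closure_range_ker x : M x -> A x = 0 -> x = 0.
Proof.
move=> /(closure_hnP ip_norm) Mx Ax0; apply: (hn_eq0 ip_norm).
apply/eqP; rewrite eq_le normA_ge0 andbT; apply/ler_addgt0Pr => e e0.
rewrite add0r leNgt; apply/negP => ex.
have [_ [z _ <-] xz] := Mx e e0.
have h : rp x (A z) = 0 by rewrite -rp_adj Ax0 /reA /ipA /= linear0l.
have := le_trans (ler_norm _) (reA_CauchySchwarz idP x (x - A z)).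
rewrite reADr (reANr idP) h subr0 -(sqr_normA idP).
have := normA_ge0 ip id x; nra.
Qed.

Lemma closure_range_inj x y : M x -> M y -> A x = A y -> x = y.
Proof.
move=> Mx My Axy; apply/eqP; rewrite -subr_eq0; apply/eqP.
apply: closure_range_ker.
  by rewrite addrC -scaleN1r; apply: closure_range_lin.
by rewrite op_add// -scaleN1r op_scale// Axy scaleN1r subrr.
Qed.

(** The vector representing [rp w] on [M] is the orthogonal projection [p] of [w]; since [w - p] is
    orthogonal to the range of [A], [A] kills it. *)
Lemma closure_range_proj w : exists2 p, M p & A p = A w.
Proof.
have [|||||p Mp hp] := @real_Riesz _ _ _ ip_norm M (rp w) (hn w).
- exact: closed_closure.
- by apply: subset_closure; exists 0 => //; rewrite op_0.
- by move=> t x y Mx My; rewrite addrC; apply: closure_range_lin.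
- by move=> t x y; rewrite reADr (reAZr idP).
- by move=> x; apply: reA_CauchySchwarz.
exists p => //; apply: (ip_real_ext ip_norm) => z.
by rewrite -!rp_adj !(reAC idP (A z)) !hp//; apply: subset_closure; exists z.
Qed.

(** [X x] is the only point of [M] that [A] sends to [S (A x)], which makes [X] linear. The uniform
    bound holds against vectors [A z] and reaches [X x] itself by density in [M]. *)
Lemma sharp_exists T : BA ip A T -> exists X, is_sharp ip A T X.
Proof.
move=> [bT rT]; have [bS adjS] := adjointP ip_norm bT.
set S := adjoint ip T in rT bS adjS *.
have h x : exists p, M p /\ A p = S (A x).
  have /rT[w _ Aw] : range (S \o A) (S (A x)) by exists x.
  by have [p Mp Ap] := closure_range_proj w; exists p; rewrite Ap Aw.
have [X hX] := choice h.
have MX x : M (X x) by case: (hX x).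
have AX x : A (X x) = S (A x) by case: (hX x).
have lX : linear X.
  move=> k x y; apply: closure_range_inj => //; first exact: closure_range_lin.
  by rewrite AX !(op_add A_bdd, op_scale A_bdd, op_add bS, op_scale bS) !AX.
have rpX x z : rp (X x) (A z) = rp (S (A x)) z by rewrite -rp_adj AX.
have [a a0 ha] := bounded_hnP ip_norm A_bdd.
have [s s0 hs] := bounded_hnP ip_norm bS.
(* At [A z = 0] the quotient is 0 by the convention on division, so the index ranges over all of
   [H]. *)
have [|||C hC] := uniform_boundedness ip_norm
  (phi := fun z x => rp (X x) (A z) / hn (A z)).
- move=> z t x y; rewrite addrC lX (reADl idP) (reAZl idP); ring.
- move=> z; exists (s * a * hn z / hn (A z)) => x.
  rewrite normrM rpX [X in _ * X <= _]ger0_norm ?invr_ge0 ?normA_ge0//.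
  rewrite mulrAC ler_wpM2r ?invr_ge0 ?normA_ge0//.
  apply: le_trans (reA_CauchySchwarz idP _ _) _.
  rewrite [leRHS]mulrAC ler_wpM2r ?normA_ge0// -mulrA.
  by apply: le_trans (hs _) _; rewrite ler_wpM2l.
- move=> x; exists (hn (X x)) => z.
  rewrite normrM [X in _ * X <= _]ger0_norm ?invr_ge0 ?normA_ge0//.
  have [->|Az0] := eqVneq (hn (A z)) 0; first by rewrite invr0 mulr0 normA_ge0.
  rewrite ler_pdivrMr; last by rewrite lt_def Az0 normA_ge0.
  exact: reA_CauchySchwarz.
have hC' x z : rp (X x) (A z) <= `|C| * hn x * hn (A z).
  have [Az0|Azn0] := eqVneq (hn (A z)) 0.
    rewrite (hn_eq0 ip_norm Az0) hn0 mulr0.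
    by rewrite (reAC idP) /reA /ipA /= linear0l.
  have Az_gt0 : 0 < hn (A z) by rewrite lt_def Azn0 normA_ge0.
  rewrite -ler_pdivrMr//; apply: le_trans (ler_norm _) (le_trans (hC z x) _).
  by rewrite ler_wpM2r ?normA_ge0 ?ler_norm.
exists X; split; first 1 last.
- by apply/funext => x; rewrite /= AX.
- by move=> _ [x _ <-].
apply: (bounded_hn ip_norm (c := `|C|)) => // x.
have [->|Xn0] := eqVneq (hn (X x)) 0; first by rewrite mulr_ge0 ?normA_ge0.
have X_gt0 : 0 < hn (X x) by rewrite lt_def Xn0 normA_ge0.
pose K := `|C| * hn x; have K0 : 0 <= K by rewrite mulr_ge0 ?normA_ge0.
rewrite -/K -(ler_pM2l X_gt0); apply/ler_addgt0Pr => e e0.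
(* Replacing [X x] by [A z] in one argument of [|X x|^2], and [|A z|] by [|X x|] in the bound, costs
   at most [D |X x - A z| <= e]. *)
pose D := hn (X x) + K; have D0 : 0 < D by rewrite ltr_pwDl.
have [|_ [z _ <-] xz] := (closure_hnP ip_norm _ _).1 (MX x) (e / D).
  by rewrite divr_gt0.
have h1 := hC' x z; rewrite -/K in h1.
have h2 := le_trans (ler_norm _) (reA_CauchySchwarz idP (X x) (X x - A z)).
have h3 : hn (A z) <= hn (X x) + hn (X x - A z).
  have := ler_normAB idP (X x) (X x - A z).
  by rewrite opprB addrC subrK.
have h4 : hn (X x - A z) * D <= e by rewrite -ler_pdivlMr// ltW.
move: h2; rewrite reADr (reANr idP) -(sqr_normA idP).
have h5 := ler_wpM2l K0 h3; rewrite /D in h4; nra.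
Qed.

Section SharpProperties.
Variable T : H -> H.
Hypothesis T_BA : BA ip A T.
Let Ts := sharp ip A T.

Lemma sharpP : is_sharp ip A T Ts.
Proof. by have := xgetPex (cst 0) (sharp_exists T_BA). Qed.

(** Both sides are the inner product of [x] with [T^* A y], because [A Ts = T^* A]. *)
Lemma sharp_adj x y : ipA ip A (T x) y = ipA ip A x (Ts y).
Proof.
have [bT _] := T_BA; have [_ ATs _] := sharpP.
have [_ adjT] := adjointP ip_norm bT.
case: A_pos => _ adjA _; rewrite /ipA !adjA adjT.
by rewrite -[A (Ts y)]/((A \o Ts) y) ATs.
Qed.

End SharpProperties.
End Sharp.

(** * A-bounded operators *)

(** A set that is empty or unbounded above has [sup] 0 by convention. *)
Lemma sup_nonneg (R : realType) (E : set R) :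
  (forall x, E x -> 0 <= x) -> 0 <= sup E.
Proof.
move=> E0; have [supE|/sup_out -> //] := pselect (has_sup E).
have [[x Ex] ubE] := supE.
exact: le_trans (E0 _ Ex) (ub_le_sup ubE Ex).
Qed.

Lemma sup_le_nonneg (R : realType) (E : set R) c :
  0 <= c -> (forall x, E x -> x <= c) -> sup E <= c.
Proof.
move=> c0 Ec; have [->|/set0P En0] := eqVneq E set0; first by rewrite sup0.
exact: ge_sup.
Qed.

Lemma Bernoulli_ineq (R : realType) (h : R) n : 0 <= h ->
  1 + n%:R * h <= (1 + h) ^+ n.
Proof.
move=> h0; elim: n => [|n IH]; first by rewrite mul0r addr0 expr0.
rewrite exprS; apply: le_trans (ler_wpM2l _ IH); last by rewrite addr_ge0.
by rewrite -natr1; have := mulr_ge0 (ler0n R n) (sqr_ge0 h); lra.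
Qed.

Section ABoundedOperators.
Variables (R : realType) (H : completeNormedModType R[i]).
Variable ip : {dot H for @Num.conj R[i]}.
Hypothesis ip_norm : forall x : H, `|x| = sqrtC (ip x x).
Variable A : H -> H.
Hypothesis A_pos : positive_operator ip A.
Implicit Types (x y z : H) (k : R[i]) (r t e : R) (S T U : H -> H).

Local Notation hn := (normA ip id).
Local Notation rp := (reA ip id).
Local Notation N := (normA ip A).
Local Notation rA := (reA ip A).
Local Notation M := (closure (range A)).
Let idP := id_positive ip.
Let A_bdd : bounded_operator A. Proof. by case: A_pos. Qed.

Definition A_bounded S := exists2 c, 0 <= c & forall x, N (S x) <= c * N x.

(** By Cauchy-Schwarz [|rp (A x) z| <= |x|_A |z|_A] for every [z]. *)
Lemma normA0_ker x : N x = 0 <-> A x = 0.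
Proof.
split=> [Nx0|Ax0]; last by rewrite /normA /ipA Ax0 linear0l sqrtr0.
apply: (ip_real_ext ip_norm) => z; apply/eqP.
rewrite -[X in _ == X]/(complex.Re (ip z 0)) linear0r /=.
rewrite -normr_eq0 eq_le normr_ge0 andbT (reAC idP).
by have := reA_CauchySchwarz A_pos x z; rewrite Nx0 mul0r.
Qed.

Lemma normA_le_hn : exists2 K, 0 <= K & forall x, N x <= K * hn x.
Proof.
have [a a0 ha] := bounded_hnP ip_norm A_bdd.
exists (Num.sqrt a); first exact: sqrtr_ge0.
move=> x; rewrite -ler_sqr ?nnegrE ?mulr_ge0 ?sqrtr_ge0 ?normA_ge0//.
rewrite (sqr_normA A_pos) exprMn [Num.sqrt a ^+ 2]sqr_sqrtr//.
apply: le_trans (ler_norm _) (le_trans (reA_CauchySchwarz idP (A x) x) _).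
by rewrite [_ ^+ 2]expr2 mulrA ler_wpM2r ?normA_ge0.
Qed.

Lemma selfadjoint_A_bounded S : bounded_operator S ->
  (forall x y, rA (S x) y = rA x (S y)) -> A_bounded S.
Proof.
move=> bS saS; have [c0 c0_ge0 hc0] := bounded_hnP ip_norm bS.
have [K K0 hK] := normA_le_hn.
(* Adding 1 makes [c] positive, hence a legitimate divisor. *)
pose c := c0 + 1; have c_gt0 : 0 < c by rewrite ltr_wpDl.
have hc x : hn (S x) <= c * hn x.
  by apply: le_trans (hc0 x) _; rewrite ler_wpM2r ?normA_ge0// lerDl.
have hn_iter m x : hn (iter m S x) <= c ^+ m * hn x.
  elim: m => [|m IH]; first by rewrite expr0 mul1r.
  by rewrite iterS exprS -mulrA; apply: le_trans (hc _) _; rewrite ler_pM2l.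
have sa_iter m x y : rA (iter m S x) y = rA x (iter m S y).
  by elim: m x => [//|m IH] x; rewrite iterSr IH saS.
have step m x : N (iter m S x) ^+ 2 <= N (iter (m + m) S x) * N x.
  rewrite (sqr_normA A_pos) -sa_iter -iterD.
  exact: le_trans (ler_norm _) (reA_CauchySchwarz A_pos _ _).
exists c; rewrite ?(ltW c_gt0)// => x.
have [Nx0|Nxn0] := eqVneq (N x) 0.
  have := step 1%N x; rewrite Nx0 mulr0 mulr0 => h.
  have : N (S x) ^+ 2 == 0 by rewrite eq_le h sqr_ge0.
  by rewrite sqrf_eq0 => /eqP ->.
have Nx_gt0 : 0 < N x by rewrite lt_def Nxn0 normA_ge0.
have pow n : (N (S x) / N x) ^+ (2 ^ n) <= N (iter (2 ^ n) S x) / N x.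
  elim: n => [|n IH]; first by rewrite expn0 expr1.
  rewrite expnSr exprM muln2 -addnn.
  have pos m : 0 <= N (iter m S x) / N x by rewrite divr_ge0 ?normA_ge0.
  apply: le_trans (_ : (N (iter (2 ^ n) S x) / N x) ^+ 2 <= _).
    by rewrite ler_sqr ?nnegrE// exprn_ge0// (pos 1%N).
  rewrite exprMn exprVn ler_pdivrMr ?exprn_gt0// expr2 mulrA divfK//.
  by rewrite -expr2 step.
rewrite leNgt; apply/negP => big.
(* Bernoulli's inequality stands in for taking roots of order [2^n]: if
   [|S x|_A / |x|_A = c (1 + h)], then [(1 + h)^(2^n)] outgrows the fixed bound [L]. *)
pose h := N (S x) / N x / c - 1.
have h_gt0 : 0 < h by rewrite subr_gt0 !ltr_pdivlMr// mul1r.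
pose L := K * hn x / N x.
have bound n : 1 + (2 ^ n)%:R * h <= L.
  apply: le_trans (Bernoulli_ineq _ (ltW h_gt0)) _.
  rewrite addrC subrK expr_div_n ler_pdivrMr ?exprn_gt0//.
  apply: le_trans (pow n) _; rewrite /L mulrAC ler_wpM2r ?invr_ge0 ?normA_ge0//.
  apply: le_trans (hK _) _; rewrite -mulrA ler_wpM2l//.
  by rewrite mulrC hn_iter.
have := bound (Num.truncn (L / h)).+1; apply/negP; rewrite -ltNge.
apply: lt_le_trans (_ : (2 ^ (Num.truncn (L / h)).+1)%:R * h <= _); last first.
  by rewrite lerDr.
rewrite -ltr_pdivrMr//; apply: lt_trans (truncnS_gt _) _.
by rewrite ltr_nat ltn_expl.
Qed.

(* Polarization together with the parallelogram law, at [y = U x / m]. *)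
Lemma selfadjoint_normA_le U m : linear U ->
  (forall x y, rA (U x) y = rA x (U y)) -> 0 <= m ->
  (forall x, `|rA (U x) x| <= m * N x ^+ 2) -> forall x, N (U x) <= m * N x.
Proof.
move=> lU saU m0 hm x.
have UP t y : U (x + t%:C *: y) = U x + t%:C *: U y by rewrite addrC lU addrC.
(* The quadratic forms of [U] at [x + t U x] and [x - t U x] differ by [4 t |U x|_A^2]; the
   parallelogram law evaluates the sum of their two bounds. *)
have key t : 4 * t * N (U x) ^+ 2 <= 2 * m * (N x ^+ 2 + t ^+ 2 * N (U x) ^+ 2).
  have /ler_normlP[_ h1] := hm (x + t%:C *: U x).
  have /ler_normlP[h2 _] := hm (x + (- t)%:C *: U x).
  have := normA_parallelogram A_pos x (t%:C *: U x).
  rewrite (normAZr A_pos) exprMn real_normK ?num_real//.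
  have <- : x + (- t)%:C *: U x = x - t%:C *: U x by rewrite rmorphN scaleNr.
  move: h1 h2; rewrite !UP.
  rewrite !(reADl A_pos, reADr, reAZl A_pos, reAZr A_pos).
  rewrite -!(sqr_normA A_pos) (saU (U x) x) -!(sqr_normA A_pos); nra.
rewrite -ler_sqr ?nnegrE ?mulr_ge0 ?normA_ge0// exprMn.
have [m_eq0|mn0] := eqVneq m 0.
  by have := key 1; rewrite m_eq0; nra.
have m_gt0 : 0 < m by rewrite lt_def mn0.
(* [t = 1 / m] maximises [4 t - 2 m t^2], the net coefficient of [|U x|_A^2] in [key]. *)
have := key m^-1.
have -> : 4 / m * N (U x) ^+ 2 = (4 * N (U x) ^+ 2) / m by rewrite mulrAC.
rewrite ler_pdivrMr//.
have -> : 2 * m * (N x ^+ 2 + m^-1 ^+ 2 * N (U x) ^+ 2) * m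
  = 2 * (m ^+ 2 * N x ^+ 2) + 2 * N (U x) ^+ 2 by field.
lra.
Qed.

Lemma opnormA_ge0 S : 0 <= opnormA ip A S.
Proof. by apply: sup_nonneg => _ [x _ <-]; rewrite divr_ge0 ?normA_ge0. Qed.

Lemma opnormA_le S c : 0 <= c -> (forall x, N (S x) <= c * N x) ->
  opnormA ip A S <= c.
Proof.
move=> c0 hc; apply: sup_le_nonneg => // _ [x _ <-].
have [->|xn0] := eqVneq (N x) 0; first by rewrite invr0 mulr0.
by rewrite ler_pdivrMr ?hc// lt_def xn0 normA_ge0.
Qed.

(** The supremum runs over the closure of the range only, so [x] is replaced by its projection [p]:
    [x - p] has A-seminorm zero and, as [S] is A-bounded, so has [S (x - p)]. *)
Lemma normA_le_opnormA S x : linear S -> A_bounded S ->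
  N (S x) <= opnormA ip A S * N x.
Proof.
move=> lS [c c0 hc]; have [p Mp Ap] := closure_range_proj ip_norm A_pos x.
have Nxp : N (x - p) = 0.
  by apply/normA0_ker; rewrite op_add// -scaleN1r op_scale// Ap scaleN1r subrr.
have NSxp : N (S (x - p)) = 0.
  by apply/eqP; rewrite eq_le normA_ge0 andbT (le_trans (hc _))// Nxp mulr0.
have Np_le : N p <= N x.
  have -> : p = x - (x - p) by rewrite subKr.
  by apply: le_trans (ler_normAB A_pos _ _) _; rewrite Nxp addr0.
have Sx : S x = S (x - p) + S p.
  by have := lS 1 (x - p) p; rewrite !scale1r subrK.
rewrite Sx; apply: le_trans (ler_normAD A_pos _ _) _; rewrite NSxp add0r.
apply: le_trans (_ : opnormA ip A S * N p <= _); last first.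
  by rewrite ler_wpM2l// opnormA_ge0.
have [p0|pn0] := eqVneq p 0.
  apply: le_trans (hc p) _.
  by rewrite p0 (normA0_ker 0).2 ?op_0// !mulr0.
have Np_gt0 : 0 < N p.
  rewrite lt_def normA_ge0 andbT; apply: contra pn0 => /eqP/normA0_ker Ap0.
  by apply/eqP; apply: (closure_range_ker ip_norm A_pos Mp).
rewrite -ler_pdivrMr//; apply: ub_le_sup; last by exists p.
(* A-boundedness bounds the quotients from above, so that [sup] is a true supremum. *)
exists c => _ [y _ <-].
have [->|yn0] := eqVneq (N y) 0; first by rewrite invr0 mulr0.
by rewrite ler_pdivrMr ?hc// lt_def yn0 normA_ge0.
Qed.

End ABoundedOperators.

(** * A-numerical radius inequalities *)

Section FormalAdjoints.
Variables (R : realType) (H : completeNormedModType R[i]).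
Variable ip : {dot H for @Num.conj R[i]}.
Variable A : H -> H.
Hypothesis A_pos : positive_operator ip A.
Implicit Types (x y z : H) (k l : R) (T Ts : H -> H).

Local Notation N := (normA ip A).
Local Notation rA := (reA ip A).

(** [T + Ts] is A-self-adjoint and its quadratic form is [2 Re <T x, x>_A]. *)
Lemma normAD_adjoint_le T Ts w : linear T -> linear Ts ->
  (forall x y, ipA ip A (T x) y = ipA ip A x (Ts y)) -> 0 <= w ->
  (forall x, Normc.normc (ipA ip A (T x) x) <= w * N x ^+ 2) ->
  forall x, N (T x + Ts x) <= 2 * w * N x.
Proof.
move=> lT lTs adj w0 hw x.
have radj u v : rA (T u) v = rA u (Ts v) by rewrite /reA adj.
apply: (selfadjoint_normA_le A_pos (U := fun x => T x + Ts x)).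
- by move=> c u v; rewrite lT lTs scalerDr addrACA.
- move=> u v; rewrite (reADl A_pos) reADr radj (reAC A_pos (Ts u)) -(radj v).
  by rewrite (reAC A_pos (T v)) addrC.
- by rewrite mulr_ge0.
move=> y; rewrite (reADl A_pos) (reAC A_pos (Ts y)) -radj.
rewrite -mulr2n normrMn -mulrA mulr_natl ler_pMn2r//.
exact: le_trans (Re_le_normc _) (hw y).
Qed.

(** [|T x + Ts x|_A] and [|T x - Ts x|_A] are both at most [2 w |x|_A]; the parallelogram law halves
    the resulting [8 w^2]. *)
Lemma sqr_normA_adjoint_le T Ts w : linear T -> linear Ts ->
  (forall x y, ipA ip A (T x) y = ipA ip A x (Ts y)) -> 0 <= w ->
  (forall x, Normc.normc (ipA ip A (T x) x) <= w * N x ^+ 2) ->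
  forall x, N (T x) ^+ 2 + N (Ts x) ^+ 2 <= 4 * w ^+ 2 * N x ^+ 2.
Proof.
move=> lT lTs adj w0 hw x.
have normc_i : Normc.normc ('i%C : R[i]) = 1.
  by rewrite /= expr0n expr1n add0r sqrtr1.
have scale_lin (c : R[i]) S : linear S -> linear (fun y => c *: S y).
  by move=> lS d u v; rewrite lS scalerDr !scalerA mulrC.
have h1 := normAD_adjoint_le lT lTs adj w0 hw x.
(* The skew part [T - Ts] is the self-adjoint part of [i T] up to a phase. *)
have h2 : N (T x - Ts x) <= 2 * w * N x.
  have -> : N (T x - Ts x) = N ('i%C *: T x + (conjc 'i%C) *: Ts x).
    have -> : conjc ('i%C : R[i]) = - 'i%C.
      by apply/eqP; rewrite eq_complex /= oppr0 !eqxx.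
    by rewrite scaleNr -scalerBr (normAZ A_pos) normc_i mul1r.
  apply: (normAD_adjoint_le (T := fun y => 'i%C *: T y)
            (Ts := fun y => (conjc 'i%C) *: Ts y)) => //.
  - exact: scale_lin.
  - exact: scale_lin.
  - by move=> u v; rewrite (ipAZl A_pos) ipAZr adj conjcK.
  by move=> y; rewrite (ipAZl A_pos) Normc.normcM normc_i mul1r.
have := normA_parallelogram A_pos (T x) (Ts x).
have c0 : 0 <= 2 * w * N x by rewrite !mulr_ge0 ?normA_ge0.
have := normA_ge0 ip A (T x + Ts x); have := normA_ge0 ip A (T x - Ts x).
have sq a : 0 <= a -> a <= 2 * w * N x -> a ^+ 2 <= 4 * w ^+ 2 * N x ^+ 2.
  move=> a0 ha; have -> : 4 * w ^+ 2 * N x ^+ 2 = (2 * w * N x) ^+ 2 by ring.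
  by rewrite ler_sqr ?nnegrE.
move=> p1 p2; have := sq _ p1 h2; have := sq _ p2 h1; lra.
Qed.

End FormalAdjoints.

(** * Bounds for a bounded operator and a bounded A-adjoint of it *)

Section MainInequalities.
Variables (R : realType) (H : completeNormedModType R[i]).
Variable ip : {dot H for @Num.conj R[i]}.
Hypothesis ip_norm : forall x : H, `|x| = sqrtC (ip x x).
Variable A : H -> H.
Hypothesis A_pos : positive_operator ip A.
Variables T Ts : H -> H.
Hypothesis bT : bounded_operator T.
Hypothesis bTs : bounded_operator Ts.
Hypothesis adj : forall x y, ipA ip A (T x) y = ipA ip A x (Ts y).
Implicit Types (x y z : H) (k l : R).

Local Notation N := (normA ip A).
Local Notation rA := (reA ip A).
Local Notation num x := (Normc.normc (ipA ip A (T x) x)).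

Let radj x y : rA (T x) y = rA x (Ts y). Proof. by rewrite /reA adj. Qed.
Let radj' x y : rA (Ts x) y = rA x (T y).
Proof. by rewrite (reAC A_pos) -radj (reAC A_pos). Qed.

(** [Ts T] is A-self-adjoint, hence A-bounded by some [c]. Then [|T x|_A^2 = <Ts T x, x>_A] gives
    the bound [sqrt c] for [T], and [|Ts x|_A^2 = <T Ts x, x>_A] carries it over to [Ts]. *)
Lemma adjoint_pair_A_bounded : A_bounded ip A T /\ A_bounded ip A Ts.
Proof.
have bTsT : bounded_operator (Ts \o T).
  have [c1 c10 h1] := bounded_hnP ip_norm bT.
  have [c2 c20 h2] := bounded_hnP ip_norm bTs.
  apply: (bounded_hn ip_norm (c := c2 * c1)) => [k x y|x] /=.
    by rewrite bT.1 bTs.1.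
  by apply: le_trans (h2 _) _; rewrite -mulrA ler_wpM2l.
have [|c c0 hc] := selfadjoint_A_bounded ip_norm A_pos bTsT.
  by move=> x y; rewrite /= radj' radj.
have [d d0 hd] : A_bounded ip A T.
  exists (Num.sqrt c); first exact: sqrtr_ge0.
  move=> x; rewrite -ler_sqr ?nnegrE ?mulr_ge0 ?sqrtr_ge0 ?normA_ge0//.
  rewrite (sqr_normA A_pos) exprMn [Num.sqrt c ^+ 2]sqr_sqrtr// -radj'.
  apply: le_trans (ler_norm _) (le_trans (reA_CauchySchwarz A_pos _ _) _).
  by rewrite expr2 mulrA ler_wpM2r ?normA_ge0// hc.
split; first by exists d.
exists d => // x; have [->|n0] := eqVneq (N (Ts x)) 0.
  by rewrite mulr_ge0 ?normA_ge0.
have n_gt0 : 0 < N (Ts x) by rewrite lt_def n0 normA_ge0.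
rewrite -(ler_pM2l n_gt0) -expr2 (sqr_normA A_pos) -radj.
apply: le_trans (ler_norm _) _; apply: le_trans (reA_CauchySchwarz A_pos _ _) _.
by rewrite mulrCA mulrA ler_wpM2r ?normA_ge0.
Qed.

(** Free coefficients cover the combinations with [alpha / 4] and [alpha / 2], and also their slope
    in [alpha], where [l] is negative. *)
Definition comb k l : H -> H :=
  k%:C *: ((Ts \o T) + (T \o Ts)) + l%:C *: (Ts \o T).

Let combE k l x :
  comb k l x = k%:C *: (Ts (T x) + T (Ts x)) + l%:C *: Ts (T x).
Proof. by []. Qed.

Let form k l x := k * (N (T x) ^+ 2 + N (Ts x) ^+ 2) + l * N (T x) ^+ 2.

Let rA_comb k l x y : rA (comb k l x) y
  = k * (rA (T x) (T y) + rA (Ts x) (Ts y)) + l * rA (T x) (T y).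
Proof.
by rewrite combE !(reADl A_pos, reAZl A_pos) (radj' (T x)) (radj (Ts x)).
Qed.

Let rA_comb_diag k l x : rA (comb k l x) x = form k l x.
Proof. by rewrite rA_comb -!(sqr_normA A_pos). Qed.

Let comb_linear k l : linear (comb k l).
Proof.
move=> c x y; rewrite !combE.
have F_lin : Ts (T (c *: x + y)) + T (Ts (c *: x + y))
    = c *: (Ts (T x) + T (Ts x)) + (Ts (T y) + T (Ts y)).
  by rewrite !bT.1 !bTs.1 bT.1 scalerDr addrACA.
rewrite F_lin bT.1 bTs.1.
move: (Ts (T x) + _) (Ts (T y) + _) => Fx Fy.
by rewrite !scalerDr !scalerA ![_%:C * c]mulrC addrACA.
Qed.

Let comb_A_bounded k l : A_bounded ip A (comb k l).
Proof.
have [[c c0 hc] [d d0 hd]] := adjoint_pair_A_bounded.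
exists (`|k| * (d * c + c * d) + `|l| * (d * c)).
  by rewrite !(addr_ge0, mulr_ge0).
move=> x; rewrite combE.
have h1 : N (Ts (T x)) <= d * c * N x.
  by apply: le_trans (hd _) _; rewrite -mulrA ler_wpM2l.
have h2 : N (T (Ts x)) <= c * d * N x.
  by apply: le_trans (hc _) _; rewrite -mulrA ler_wpM2l.
apply: le_trans (ler_normAD A_pos _ _) _; rewrite !(normAZr A_pos) mulrDl.
rewrite -!mulrA; apply: lerD; apply: ler_wpM2l => //; last by rewrite mulrA.
by apply: le_trans (ler_normAD A_pos _ _) _; rewrite mulrDl lerD.
Qed.

(** Nonnegative [k] and [l] make the form nonnegative, so a one-sided pointwise bound controls the
    seminorm of this A-self-adjoint operator. *)
Let opnorm_comb_le k l c : 0 <= k -> 0 <= l -> 0 <= c ->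
  (forall x, form k l x <= c * N x ^+ 2) -> opnormA ip A (comb k l) <= c.
Proof.
move=> k0 l0 c0 h; apply: opnormA_le => //.
apply: (selfadjoint_normA_le A_pos) => //.
  move=> x y; rewrite rA_comb (reAC A_pos x) rA_comb.
  by rewrite !(reAC A_pos (T y)) (reAC A_pos (Ts y)).
move=> x; rewrite rA_comb_diag ger0_norm ?h// /form.
by apply: addr_ge0; apply: mulr_ge0; rewrite ?addr_ge0 ?sqr_ge0.
Qed.

Let form_le_opnorm k l x : form k l x <= opnormA ip A (comb k l) * N x ^+ 2.
Proof.
rewrite -rA_comb_diag.
apply: le_trans (ler_norm _) (le_trans (reA_CauchySchwarz A_pos _ _) _).
rewrite [_ ^+ 2]expr2 mulrA ler_wpM2r ?normA_ge0//.
exact: normA_le_opnormA.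
Qed.

Let num_le_T x : num x <= N (T x) * N x.
Proof. exact: ipA_CauchySchwarz. Qed.

Let num_le_Ts x : num x <= N (Ts x) * N x.
Proof. by rewrite adj mulrC ipA_CauchySchwarz. Qed.

(** Since [<T x, x>_A = <x, Ts x>_A], the value is bounded by both seminorms, hence its square by
    the mean of their squares. *)
Let num_le_avg x : N x = 1 ->
  num x ^+ 2 <= 2^-1 * (N (T x) ^+ 2 + N (Ts x) ^+ 2).
Proof.
move=> Nx; have := num_le_T x; have := num_le_Ts x; rewrite Nx !mulr1.
by have := normc_ge0 (ipA ip A (T x) x); move: (num x) => a; nra.
Qed.

(** * Bounds at a fixed [alpha] *)

Section Alpha.
Variable alpha : R.
Hypothesis alpha01 : 0 <= alpha <= 1.

Local Notation V x :=
  (alpha * num x ^+ 2 + (1 - alpha) * N (T x) ^+ 2).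
Local Notation Na := (normA_alpha ip A alpha T).

Let alpha_ge0 : 0 <= alpha. Proof. by case/andP: alpha01. Qed.
Let alpha_le1 : 0 <= 1 - alpha. Proof. by case/andP: alpha01; lra. Qed.

Let V_ge0 x : 0 <= V x.
Proof. by rewrite addr_ge0// mulr_ge0// sqr_ge0. Qed.

Let V_le x : N x = 1 -> V x <= form (alpha / 2) (1 - alpha) x.
Proof.
move=> Nx; rewrite /form -mulrA lerD2r ler_wpM2l//.
exact: num_le_avg.
Qed.

Lemma normA_alpha_ge0 : 0 <= Na.
Proof. by apply: sup_nonneg => _ [x _ <-]; rewrite sqrtr_ge0. Qed.

Lemma sqr_normA_alpha_le :
  Na ^+ 2 <= opnormA ip A (comb (alpha / 2) (1 - alpha)).
Proof.
set op := opnormA _ _ _; have op0 : 0 <= op by apply: opnormA_ge0.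
rewrite -[leRHS](sqr_sqrtr op0) ler_sqr ?nnegrE ?normA_alpha_ge0 ?sqrtr_ge0//.
apply: sup_le_nonneg => [|_ [x /= Nx <-]]; first exact: sqrtr_ge0.
rewrite ler_wsqrtr//; apply: le_trans (V_le Nx) _.
by have := form_le_opnorm (alpha / 2) (1 - alpha) x; rewrite Nx expr1n mulr1.
Qed.

Let V_le_Na x : N x = 1 -> V x <= Na ^+ 2.
Proof.
move=> Nx; rewrite -[leLHS](sqr_sqrtr (V_ge0 x)).
rewrite ler_sqr ?nnegrE ?normA_alpha_ge0 ?sqrtr_ge0//.
apply: ub_le_sup; last by exists x.
exists (Num.sqrt (opnormA ip A (comb (alpha / 2) (1 - alpha)))).
move=> _ [y /= Ny <-].
rewrite ler_wsqrtr//; apply: le_trans (V_le Ny) _.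
by have := form_le_opnorm (alpha / 2) (1 - alpha) y; rewrite Ny expr1n mulr1.
Qed.

(** [V] is evaluated at the normalised vector and its other summand, which is nonnegative, dropped.
    On A-null vectors [T x] is A-null by A-boundedness. *)
Let sqr_normAT_le x : (1 - alpha) * N (T x) ^+ 2 <= Na ^+ 2 * N x ^+ 2.
Proof.
have [[c c0 hc] _] := adjoint_pair_A_bounded.
have [Nx0|Nxn0] := eqVneq (N x) 0.
  have := hc x; rewrite Nx0 mulr0 => h.
  have -> : N (T x) = 0 by apply/eqP; rewrite eq_le h normA_ge0.
  by rewrite expr0n !mulr0.
have Nx_gt0 : 0 < N x by rewrite lt_def Nxn0 normA_ge0.
have Ny : N ((N x)^-1%:C *: x) = 1.
  by rewrite (normAZr A_pos) ger0_norm ?mulVf// invr_ge0 normA_ge0.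
have := V_le_Na Ny.
rewrite (op_scale bT) (normAZr A_pos) exprMn.
rewrite real_normK ?num_real//.
have := mulr_ge0 alpha_ge0 (sqr_ge0 (num ((N x)^-1%:C *: x))).
rewrite (op_scale bT) => h1 h2.
have {h1 h2} : (1 - alpha) * ((N x)^-1 ^+ 2 * N (T x) ^+ 2) <= Na ^+ 2 by lra.
by rewrite exprVn mulrCA mulrC ler_pdivrMr ?exprn_gt0.
Qed.

Let num_le_Na x : alpha * num x ^+ 2 <= Na ^+ 2 * (N x ^+ 2) ^+ 2.
Proof.
have [Nx0|Nxn0] := eqVneq (N x) 0.
  have := num_le_T x; rewrite Nx0 mulr0 => h.
  have -> : num x = 0 by apply/eqP; rewrite eq_le h normc_ge0.
  by rewrite expr0n /= expr0n /= !mulr0.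
have Nx_gt0 : 0 < N x by rewrite lt_def Nxn0 normA_ge0.
have Ny : N ((N x)^-1%:C *: x) = 1.
  by rewrite (normAZr A_pos) ger0_norm ?mulVf// invr_ge0 normA_ge0.
have := V_le_Na Ny.
have := mulr_ge0 alpha_le1 (sqr_ge0 (N (T ((N x)^-1%:C *: x)))).
move: ((1 - alpha) * _) => b b0.
rewrite (op_scale bT) (ipAZl A_pos) ipAZr !Normc.normcM normc_conjc normc_real.
rewrite ger0_norm ?invr_ge0 ?normA_ge0// => h.
have {h b0} : alpha * ((N x)^-1 * ((N x)^-1 * num x)) ^+ 2 <= Na ^+ 2 by lra.
have -> : alpha * ((N x)^-1 * ((N x)^-1 * num x)) ^+ 2
  = alpha * num x ^+ 2 / (N x ^+ 2) ^+ 2 by field.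
by rewrite ler_pdivrMr ?exprn_gt0.
Qed.

Let sqr_sum_le x :
  alpha * (N (T x) ^+ 2 + N (Ts x) ^+ 2) <= 4 * Na ^+ 2 * N x ^+ 2.
Proof.
have Na0 := normA_alpha_ge0.
have [->|an0] := eqVneq alpha 0; first by rewrite mul0r -mulrA
  -exprMn mulr_ge0 ?sqr_ge0.
have a_gt0 : 0 < alpha by rewrite lt_def an0.
have sa0 : 0 < Num.sqrt alpha by rewrite sqrtr_gt0.
(* By [num_le_Na], [Na / sqrt alpha] bounds the A-numerical radius, so [4 w^2] becomes
   [4 Na^2 / alpha]. *)
have := @sqr_normA_adjoint_le _ _ ip A A_pos T Ts (Na / Num.sqrt alpha)
  bT.1 bTs.1 adj _ _ x.
rewrite expr_div_n [Num.sqrt alpha ^+ 2]sqr_sqrtr// => h.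
have : N (T x) ^+ 2 + N (Ts x) ^+ 2 <= 4 * (Na ^+ 2 / alpha) * N x ^+ 2.
  apply: h => [|y]; first by rewrite divr_ge0// ltW.
  have w0 : 0 <= Na / Num.sqrt alpha by rewrite divr_ge0// ltW.
  rewrite -ler_sqr ?nnegrE ?normc_ge0 ?(mulr_ge0 w0) ?sqr_ge0//.
  rewrite exprMn expr_div_n [Num.sqrt alpha ^+ 2]sqr_sqrtr//.
  by rewrite mulrAC ler_pdivlMr// mulrC num_le_Na.
rewrite -(ler_pM2l a_gt0) => {}h; apply: le_trans h _.
by rewrite le_eqVlt; apply/orP; left; apply/eqP; field.
Qed.

(** Each of the two summands of the form is at most [Na^2 |x|_A^2]. *)
Lemma opnormA_comb4_le :
  opnormA ip A (comb (alpha / 4) (1 - alpha)) <= 2 * Na ^+ 2.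
Proof.
apply: opnorm_comb_le => //;
  rewrite ?divr_ge0 ?mulr_ge0 ?normA_alpha_ge0// => x.
by have := sqr_sum_le x; have := sqr_normAT_le x; rewrite /form; lra.
Qed.

(** The first summand of the form is now at most [2 Na^2 |x|_A^2], the second still at most
    [Na^2 |x|_A^2]. *)
Lemma opnormA_comb2_le :
  opnormA ip A (comb (alpha / 2) (1 - alpha)) <= 3 * Na ^+ 2.
Proof.
apply: opnorm_comb_le => //;
  rewrite ?divr_ge0 ?mulr_ge0 ?normA_alpha_ge0// => x.
by have := sqr_sum_le x; have := sqr_normAT_le x; rewrite /form; lra.
Qed.

Lemma sqr_numradA_le :
  numradA ip A T ^+ 2 <= opnormA ip A (comb (alpha / 2) (1 - alpha)).
Proof.
set op := opnormA _ _ _; have op0 : 0 <= op by apply: opnormA_ge0.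
have w0 : 0 <= numradA ip A T.
  by apply: sup_nonneg => _ [x _ <-]; rewrite normc_ge0.
rewrite -[leRHS](sqr_sqrtr op0) ler_sqr ?nnegrE ?sqrtr_ge0//.
apply: sup_le_nonneg => [|_ [x /= Nx <-]]; first exact: sqrtr_ge0.
rewrite -ler_sqr ?nnegrE ?normc_ge0 ?sqrtr_ge0// sqr_sqrtr//.
(* On A-unit vectors [num x <= |T x|_A], so [num x ^+ 2] is below the convex combination [V x]. *)
apply: le_trans (_ : V x <= _); last first.
  apply: le_trans (V_le Nx) _.
  by have := form_le_opnorm (alpha / 2) (1 - alpha) x; rewrite Nx expr1n mulr1.
have : num x ^+ 2 <= N (T x) ^+ 2.
  rewrite ler_sqr ?nnegrE ?normc_ge0 ?normA_ge0//.
  by have := num_le_T x; rewrite Nx mulr1.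
by move: alpha_le1; nra.
Qed.

End Alpha.

(** * Dependence on [alpha] *)

Local Notation f :=
  (fun alpha : R => opnormA ip A (comb (alpha / 2) (1 - alpha))).

(** The combination is affine in [alpha] with slope [comb (1 / 2) (- 1)]; an A-bound of the slope is
    a Lipschitz constant. *)
Let opnorm_comb_Lipschitz :
  exists2 K, 0 <= K & forall a b, f a <= f b + K * `|a - b|.
Proof.
have [c c0 hc] := comb_A_bounded (1 / 2) (- 1).
exists c => // a b; apply: opnormA_le => [|x].
  by rewrite addr_ge0 ?opnormA_ge0 ?mulr_ge0.
have -> : comb (a / 2) (1 - a) x
  = comb (b / 2) (1 - b) x + (a - b)%:C *: comb (1 / 2) (- 1) x.
  rewrite !combE; move: (Ts (T x) + _) => F.
  rewrite scalerDr !scalerA addrACA -!scalerDl.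
  rewrite -!rmorphM -!rmorphD.
  by congr (_%:C *: _ + _%:C *: _); field.
apply: le_trans (ler_normAD A_pos _ _) _; rewrite mulrDl; apply: lerD.
  exact: normA_le_opnormA.
by rewrite (normAZr A_pos) [c * _]mulrC -mulrA ler_wpM2l.
Qed.

Lemma opnormA_comb_continuous : continuous f.
Proof.
have [K K0 hK] := opnorm_comb_Lipschitz.
move=> a; apply/cvgrPdist_lt => e e0.
near=> b.
have h1 := hK a b; have h2 := hK b a; rewrite distrC in h2.
have : K * `|a - b| < e.
  apply: le_lt_trans (_ : (K + 1) * `|a - b| < _).
    by rewrite ler_wpM2r// lerDl.
  rewrite -ltr_pdivlMl ?ltr_wpDl//.
  near: b; apply/nbhs_ballP; exists ((K + 1)^-1 * e) => //=.
  by rewrite mulr_gt0 ?invr_gt0 ?ltr_wpDl.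
by rewrite ltr_norml; lra.
Unshelve. all: by end_near. Qed.

Lemma opnormA_comb_min : exists2 a, 0 <= a <= 1
  & forall b, 0 <= b <= 1 -> f a <= f b.
Proof.
have [||a a01 ha] := @EVT_min R f 0 1; first exact: ler01.
  exact/continuous_subspaceT/opnormA_comb_continuous.
exists a; first by move: a01; rewrite in_itv.
by move=> b b01; apply: ha; rewrite in_itv.
Qed.

Lemma opnormA_comb_half :
  f 1 <= 1 / 2 * opnormA ip A ((Ts \o T) + (T \o Ts)).
Proof.
have E : (Ts \o T) + (T \o Ts) = comb 1 0.
  by apply/funext => x; rewrite combE scale1r scale0r addr0.
apply: opnormA_le => [|x]; first by rewrite mulr_ge0 ?opnormA_ge0.
have -> : comb (1 / 2) (1 - 1) x = (1 / 2 : R)%:C *: comb 1 0 x.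
  by rewrite !combE subrr !scale0r !addr0 scale1r.
rewrite (normAZr A_pos) ger0_norm// -[leRHS]mulrA ler_wpM2l// E.
exact: normA_le_opnormA.
Qed.

End MainInequalities.

Theorem theorem2p8 (R : realType) (H : completeNormedModType R[i])
    (ip : {dot H for @Num.conj R[i]})
    (ip_norm : forall x : H, `|x| = sqrtC (ip x x))
    (A : H -> H) (A_pos : positive_operator ip A)
    (T : H -> H) (T_BA : BA ip A T) :
  let Ts := sharp ip A T in
  [/\ forall alpha : R, 0 <= alpha <= 1 ->
        Num.max
          (1 / 2 * opnormA ip A ((alpha / 4)%:C *: ((Ts \o T) + (T \o Ts))
                                 + (1 - alpha)%:C *: (Ts \o T)))
          (1 / 3 * opnormA ip A ((alpha / 2)%:C *: ((Ts \o T) + (T \o Ts))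
                                 + (1 - alpha)%:C *: (Ts \o T)))
        <= normA_alpha ip A alpha T ^+ 2,
      forall alpha : R, 0 <= alpha <= 1 ->
        normA_alpha ip A alpha T ^+ 2
        <= opnormA ip A ((alpha / 2)%:C *: ((Ts \o T) + (T \o Ts))
                         + (1 - alpha)%:C *: (Ts \o T))
    & exists2 m : R,
        is_minimum [set opnormA ip A ((alpha / 2)%:C *: ((Ts \o T) + (T \o Ts))
                                      + (1 - alpha)%:C *: (Ts \o T))
                   | alpha in [set alpha : R | 0 <= alpha <= 1]] m
      & numradA ip A T ^+ 2 <= m <= 1 / 2 * opnormA ip A ((Ts \o T) + (T \o Ts))].
Proof.
move=> Ts; have [bT _] := T_BA.
have [bTs _ _] := sharpP ip_norm A_pos T_BA.
have adj := sharp_adj ip_norm A_pos T_BA.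
rewrite -/Ts in bTs adj.
split=> [alpha a01|alpha a01|].
- have := opnormA_comb4_le ip_norm A_pos bT bTs adj a01.
  have := opnormA_comb2_le ip_norm A_pos bT bTs adj a01.
  by rewrite /comb ge_max => h3 h2; apply/andP; split; lra.
- exact: (sqr_normA_alpha_le ip_norm A_pos bT bTs adj a01).
have [a a01 ha] := opnormA_comb_min ip_norm A_pos bT bTs adj.
exists (opnormA ip A (comb T Ts (a / 2) (1 - a))).
  by split; [exists a|move=> _ [b /= b01 <-]; exact: ha].
apply/andP; split; first exact: sqr_numradA_le.
(* The minimum is compared with the value at [alpha = 1], where only half of [Ts T + T Ts]
   remains. *)
apply: le_trans (ha 1 _) _; first by rewrite ler01 lexx.
exact: opnormA_comb_half.
Qed.
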